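(* Let $K$ be a field and let $S=K[x_1,\ldots,x_n]$ be the polynomial ring in $n$ indeterminates over $K$. (a) Let $u=x_ix_j$ with $i\le j$ be a monomial of degree $2$ in $S$. Then $B(u)$ is Freiman if and only if $j\le 3$, or $j>3$ and $i\le 2$. (b) Let $i,j,d$ be integers with $d\ge 3$ and $1\le i\le j\le n$, and let $u=x_i^{d-1}x_j$. Then $B(u)$ is Freiman if $i\le 2$.
   Context: For a monomial ideal $I$, $G(I)$ denotes its unique minimal set of monomial generators; for a monomial $u$, $\operatorname{supp}(u)=\{i\mid x_i \text{ divides } u\}$. A monomial ideal $I\subset S$ is strongly stable if for all $u\in G(I)$, all $j\in\operatorname{supp}(u)$ and all $i<j$ one has $x_i(u/x_j)\in I$. For a monomial $u$, the principal Borel ideal $B(u)$ is the unique smallest strongly stable ideal containing $u$. For a graded ideal $I\subset S$, $\mu(I)$ denotes the minimal number of generators of $I$; the fiber cone is $F(I)=\bigoplus_{k\ge 0} I^k/\mathfrak m I^k$ with $\mathfrak m=(x_1,\ldots,x_n)$, and the analytic spread $\ell(I)$ is the Krull dimension of $F(I)$. A monomial ideal $I$ that is equigenerated (minimally generated by monomials of one degree) is called Freiman if $\mu(I^2)=\ell(I)\mu(I)-\binom{\ell(I)}{2}$. *)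

(* Defs.v *)
From HB Require Import structures.
From mathcomp Require Import all_boot all_order all_algebra.
From mathcomp Require Import boolp.
From mathcomp Require Import mpoly.

Set Implicit Arguments.
Unset Strict Implicit.
Unset Printing Implicit Defensive.

Import GRing.Theory.
Local Open Scope ring_scope.

(* Subsets of a ring are predicates [{pred R}], made boolean by the classical
   [`[< _ >]]; they are compared with [=i].  The library's [idealr] only covers
   proper ideals, whereas the unit ideal is needed here (as I^0 in particular). *)

Section Ideals.
Variable R : comNzRingType.
Implicit Types (G I J : {pred R}).

Definition ideal_gen G : {pred R} := fun f =>
  `[< exists2 s : seq (R * R),
        {in s, forall p, p.2 \in G} & f = \sum_(p <- s) p.1 * p.2 >].

Definition ideal_mul I J : {pred R} :=
  ideal_gen (fun h => `[< exists f g, [/\ f \in I, g \in J & h = f * g] >]).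

Definition ideal_pow I (k : nat) : {pred R} := iter k (ideal_mul I) predT.

Lemma ideal_genP G f :
  reflect (exists2 s : seq (R * R),
             {in s, forall p, p.2 \in G} & f = \sum_(p <- s) p.1 * p.2)
          (f \in ideal_gen G).
Proof. exact: asboolP. Qed.

Lemma ideal_gen0 G : 0 \in ideal_gen G.
Proof. by apply/ideal_genP; exists [::]; rewrite ?big_nil. Qed.

Lemma ideal_gen1 G f : f \in G -> f \in ideal_gen G.
Proof.
move=> fG; apply/ideal_genP; exists [:: (1, f)].
  by move=> p; rewrite inE => /eqP ->.
by rewrite big_seq1 mul1r.
Qed.

Lemma ideal_genD G f g :
  f \in ideal_gen G -> g \in ideal_gen G -> f + g \in ideal_gen G.
Proof.
move=> /ideal_genP[s sG ->] /ideal_genP[t tG ->].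
apply/ideal_genP; exists (s ++ t); last by rewrite big_cat.
by move=> p; rewrite mem_cat => /orP[/sG|/tG].
Qed.

Lemma ideal_genM G a f : f \in ideal_gen G -> a * f \in ideal_gen G.
Proof.
move=> /ideal_genP[s sG ->]; apply/ideal_genP.
exists [seq (a * p.1, p.2) | p <- s]; first by move=> _ /mapP[p /sG pG ->].
by rewrite big_map mulr_sumr; apply: eq_bigr => p _; rewrite mulrA.
Qed.

Lemma ideal_gen_sum (T : Type) (r : seq T) (P : pred T) (F : T -> R) G :
  (forall i, P i -> F i \in ideal_gen G) ->
  \sum_(i <- r | P i) F i \in ideal_gen G.
Proof.
by move=> FG; elim/big_ind: _ => //; [exact: ideal_gen0 | exact: ideal_genD].
Qed.

Lemma ideal_mulM I J f g : f \in I -> g \in J -> f * g \in ideal_mul I J.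
Proof. by move=> fI gJ; apply: ideal_gen1; apply/asboolP; exists f, g. Qed.

Lemma ideal_mul_ind I J (P : R -> Prop) :
    P 0 -> (forall f g, P f -> P g -> P (f + g)) ->
    (forall a f g, f \in I -> g \in J -> P (a * (f * g))) ->
  forall h, h \in ideal_mul I J -> P h.
Proof.
move=> P0 PD PM h /ideal_genP[s sG ->]; rewrite big_seq.
elim/big_ind: _ => // p /sG /asboolP[f [g [fI gJ ->]]]; exact: PM.
Qed.

Lemma ideal_pow0 I k : 0 \in ideal_pow I k.
Proof. by case: k => // k; apply: ideal_gen0. Qed.

Lemma ideal_powD I k f g :
  f \in ideal_pow I k -> g \in ideal_pow I k -> f + g \in ideal_pow I k.
Proof. by case: k => // k; apply: ideal_genD. Qed.

Lemma ideal_powMl I k a f : f \in ideal_pow I k -> a * f \in ideal_pow I k.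
Proof. by case: k => // k; apply: ideal_genM. Qed.

Lemma ideal_powM I k l f g :
  f \in ideal_pow I k -> g \in ideal_pow I l -> f * g \in ideal_pow I (k + l).
Proof.
elim: k f => [|k IHk] f fI gI; first exact: ideal_powMl.
rewrite addSn; move: f fI; apply: ideal_mul_ind.
- by rewrite mul0r; apply: ideal_gen0.
- by move=> f1 f2 H1 H2; rewrite mulrDl; apply: ideal_genD.
move=> a f1 f2 f1I f2I; rewrite -!mulrA; apply: ideal_genM.
by apply: ideal_mulM => //; apply: IHk.
Qed.

Definition generated_by I (r : nat) : Prop :=
  exists s : r.-tuple R, I =i ideal_gen (mem s).

(* mu(I) = r *)
Definition min_number_gens I (r : nat) : Prop :=
  generated_by I r /\ forall s, generated_by I s -> (r <= s)%N.

End Ideals.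

Section KrullDimension.
Variable A : comNzRingType.

Definition prime_ideal (P : {pred A}) : Prop :=
  idealr_closed P /\ prime_idealr_closed P.

Definition prime_chain (d : nat) (P : 'I_d.+1 -> {pred A}) : Prop :=
  (forall i, prime_ideal (P i)) /\
  (forall i j : 'I_d.+1, (i < j)%N ->
     {subset P i <= P j} /\ ~ {subset P j <= P i}).

(* dim A = d *)
Definition krull_dim (d : nat) : Prop :=
  (exists P : 'I_d.+1 -> {pred A}, prime_chain P) /\
  (forall e (P : 'I_e.+1 -> {pred A}), prime_chain P -> (e <= d)%N).

End KrullDimension.

(* The fiber cone (+)_k I^k / m I^k is realized as the quotient of the Rees
   algebra (+)_k I^k t^k, a subring of S[t], by the ideal (+)_k (m I^k) t^k. *)
Section FiberCone.
Variables (K : fieldType) (n : nat).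
Local Notation S := {mpoly K[n]}.

Definition max_ideal : {pred S} :=
  ideal_gen (fun f => `[< exists i : 'I_n, f = 'X_i >]).

Variable I : {pred S}.

Definition rees_pred : {pred {poly S}} :=
  fun p => `[< forall k, p`_k \in ideal_pow I k >].

Lemma rees_subring_closed : subring_closed rees_pred.
Proof.
split=> [|p q /asboolP pI /asboolP qI|p q /asboolP pI /asboolP qI].
- apply/asboolP=> -[|k] //; rewrite coef1; exact: ideal_pow0.
- apply/asboolP=> k; rewrite coefB -mulN1r.
  by apply: ideal_powD => //; apply: ideal_powMl.
apply/asboolP=> k; rewrite coefM.
elim/big_ind: _ => [||i _]; [exact: ideal_pow0 | exact: ideal_powD |].
have := ideal_powM (pI i) (qI (k - i)%N); rewrite subnKC //.
by rewrite -ltnS ltn_ord.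
Qed.

HB.instance Definition _ :=
  GRing.isSubringClosed.Build {poly S} rees_pred rees_subring_closed.

Record rees := Rees { rees_val : {poly S}; _ : rees_val \in rees_pred }.

HB.instance Definition _ := [isSub for rees_val].
HB.instance Definition _ := [Choice of rees by <:].
HB.instance Definition _ := [SubChoice_isSubComNzRing of rees by <:].

Definition fiber_ideal : {pred rees} :=
  fun p => `[< forall k,
    (val p)`_k \in ideal_mul max_ideal (ideal_pow I k) >].

Lemma max_ideal_coef0 f : f \in max_ideal -> f@_0%MM = 0.
Proof.
move=> /ideal_genP[s sG ->]; rewrite big_seq raddf_sum big1 // => p /sG.
move=> /asboolP[i Ei]; rewrite /= Ei rmorphM /= mcoeffX.
by rewrite mnm1_eq0 mulr0.
Qed.

Lemma fiber_idealr_closed : idealr_closed fiber_ideal.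
Proof.
split.
- apply/asboolP=> k; rewrite rmorph0 coef0; exact: ideal_gen0.
- apply/negP=> /asboolP/(_ 0%N); rewrite rmorph1 coef1 /= => H.
  suff: (1 : S)@_0%MM = 0 by rewrite mcoeff1 eqxx => /eqP; rewrite oner_eq0.
  move: (1 : S) H; apply: ideal_mul_ind => [|f g f0 g0|a f g fm _].
  + by rewrite raddf0.
  + by rewrite mcoeffD f0 g0 addr0.
  by rewrite !rmorphM /= (max_ideal_coef0 fm) mul0r mulr0.
move=> a u v /asboolP uI /asboolP vI; apply/asboolP=> k.
rewrite rmorphD rmorphM coefD; apply: ideal_genD => //.
rewrite coefM; apply: ideal_gen_sum => i _.
case: a => a /= /asboolP aI.
have lik : (i <= k)%N by rewrite -ltnS ltn_ord.
rewrite -[k in ideal_pow I k](subnKC lik).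
move: (_`_(k - i)) (uI (k - i)%N); apply: ideal_mul_ind.
- rewrite mulr0; exact: ideal_gen0.
- by move=> f g Hf Hg; rewrite mulrDr; apply: ideal_genD.
move=> b f g fm gI; rewrite mulrCA; apply: ideal_genM.
rewrite mulrCA; apply: ideal_mulM => //; exact: ideal_powM.
Qed.

HB.instance Definition _ :=
  isIdealr.Build rees fiber_ideal fiber_idealr_closed.

Definition fiber_cone : comNzRingType := {ideal_quot fiber_ideal}.

(* ell(I) = l *)
Definition analytic_spread (l : nat) : Prop := krull_dim fiber_cone l.

End FiberCone.

(* Monomials are exponent vectors [u : 'X_{1..n}], with [(_ + _)%MM] as
   multiplication and [(_ <= _)%MM] as divisibility. *)
Section MonomialIdeals.
Variables (K : fieldType) (n : nat).
Local Notation S := {mpoly K[n]}.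
Implicit Types (G H : {pred 'X_{1..n}}) (I J : {pred S}) (u : 'X_{1..n}).

Definition monomial_gens G I : Prop :=
  I =i ideal_gen (fun f : S => `[< exists2 u, u \in G & f = 'X_[u] >]).

(* [minimal_gens G I]: I is a monomial ideal and G = G(I). *)
Definition minimal_gens G I : Prop :=
  monomial_gens G I /\
  forall H, {subset H <= G} -> monomial_gens H I -> H =i G.

Definition supp u : {set 'I_n} := [set i | (U_(i) <= u)%MM].

Definition strongly_stable I : Prop :=
  exists2 G, minimal_gens G I &
    forall u, u \in G -> forall i j : 'I_n, j \in supp u -> (i < j)%N ->
      'X_[(U_(i) + (u - U_(j)))%MM] \in I.

(* B(u), the smallest strongly stable ideal containing u, as the intersection
   of all of them. *)
Definition principal_borel u : {pred S} :=
  fun f => `[< forall J, strongly_stable J -> 'X_[u] \in J -> f \in J >].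

Definition equigenerated I : Prop :=
  exists2 G, minimal_gens G I &
    exists d, forall u, u \in G -> mdeg u = d.

Definition freiman I : Prop :=
  equigenerated I /\
  exists mu1 mu2 l : nat,
    [/\ min_number_gens I mu1, min_number_gens (ideal_pow I 2) mu2,
        analytic_spread I l &
        mu2%:Z = l%:Z * mu1%:Z - 'C(l, 2)%:Z].

End MonomialIdeals.

Arguments principal_borel K {n} u.

(* Main.v *)
Require Import Defs.
From HB Require Import structures.
From mathcomp Require Import all_boot all_order all_algebra.
From mathcomp Require Import zify boolp.
From mathcomp Require Import mpoly.

Set Implicit Arguments.
Unset Strict Implicit.
Unset Printing Implicit Defensive.

Import GRing.Theory.

(** Number the variables from 1 and put p = i + 1 and q = j + 1.  Everything
    rests on three computations for u = x_p^(d-1) x_q.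

    Generators.  Moving indices down turns u into exactly the monomials of
    degree d in x_1, ..., x_q whose degree in the tail variables
    x_(p+1), ..., x_q is at most 1 ([principal_borel_pow]).  A monomial of
    degree k d whose tail degree is at most k splits into k such monomials, so
    B(u)^k is generated by the monomials of degree k d in x_1, ..., x_q of tail
    degree at most k ([mon_pow_tail_bounded]).  Monomial generators of one
    common degree are linearly independent modulo m I, so their number is
    mu(I) ([min_number_gens_mon]), and sorting by tail degree s gives
      mu(B(u)^k) = sum_(s <= k) C(k d - s + p - 1, k d - s) C(s + q - p - 1, s)
    ([tail_bounded_enum]).

    Analytic spread.  The fiber cone of an ideal generated in degree d by
    monomials is the toric ring of these monomials, and here its dimension is q
    ([analytic_spread_mon]).  For the upper bound, more than q elements of the
    fiber cone are algebraically dependent because their power products live in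
    a space of polynomials in q variables that grows too slowly
    ([rees_monomials_dependent]); and along a chain of primes, elements taken
    from the successive differences can satisfy no polynomial relation: reading
    off the lexicographically smallest monomial of the relation puts a nonzero
    constant into the top prime ([prime_chain_not_dependent]).  For the lower
    bound, the variables x_q, x_(q-1), ..., x_1 are set to zero one after the
    other; x_1^(d-1) x_a witnesses that the contracted primes are distinct.

    Arithmetic.  The Freiman condition becomes a polynomial identity in d and
    m = q - p, true for p = 1 and p = 2 ([freiman_equation_le2]) and for
    p = q = 3, d = 2.  For d = 2, p >= 3 and q >= 4 the difference of the two
    sides, written in a = p - 3 and m, has only nonnegative coefficients
    ([freiman_equation_degree2]). *)

(** * Monomial ideals and their powers *)

Lemma pred_ext (T : Type) (A B : {pred T}) : A =i B -> A = B.
Proof. by move=> AB; apply: funext => x; apply: AB. Qed.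

Section MonomialIdeals.
Local Open Scope ring_scope.
Variables (K : fieldType) (n : nat).
Local Notation S := {mpoly K[n]}.
Implicit Types (G H : {pred 'X_{1..n}}) (f : S).

Definition mon_ideal G : {pred S} :=
  ideal_gen (fun f : S => `[< exists2 u, u \in G & f = 'X_[u] >]).

Lemma mon_ideal_gen G g : g \in G -> 'X_[g] \in mon_ideal G.
Proof. by move=> gG; apply/ideal_gen1/asboolP; exists g. Qed.

Lemma mon_ideal_mem G f m : f \in mon_ideal G -> f@_m != 0 ->
  exists2 g, g \in G & (g <= m)%MM.
Proof.
case/ideal_genP=> s sG ->; apply: contra_neqP => noG.
rewrite raddf_sum big_seq big1 // => -[a b] /sG /asboolP[g gG /= ->].
rewrite mulrC mcoeffM big1 //= => -[k1 k2] /= /eqP mE.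
rewrite mcoeffX; case: (g =P k1 :> 'X_{1..n}) => [gE|_]; last by rewrite mul0r.
by case: noG; exists g => //; rewrite mE gE lem_addr.
Qed.

(** A monomial ideal is determined by divisibility of the monomials that occur;
    all later membership proofs go through this coefficientwise criterion. *)
Lemma mon_idealP G f :
  reflect (forall m, f@_m != 0 -> exists2 g, g \in G & (g <= m)%MM)
          (f \in mon_ideal G).
Proof.
apply: (iffP idP) => [fG m|fG]; first exact: mon_ideal_mem.
rewrite [f]mpolyE big_seq; apply: ideal_gen_sum => m.
rewrite mcoeff_msupp => /fG[g gG gm].
rewrite -mul_mpolyC -(submK gm) mpolyXD mulrA.
by apply: ideal_genM; apply: mon_ideal_gen.
Qed.

Lemma mon_idealXP G m :
  reflect (exists2 g, g \in G & (g <= m)%MM) ('X_[m] \in mon_ideal G).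
Proof.
apply: (iffP (mon_idealP _ _)) => [/(_ m)|[g gG gm] m'].
  by rewrite mcoeffX eqxx oner_neq0; apply.
rewrite mcoeffX; case: (m =P m') => [<- _|_ /eqP //].
by exists g.
Qed.

Definition mon_sum G H : {pred 'X_{1..n}} :=
  fun m => `[< exists g h, [/\ g \in G, h \in H & m = (g + h)%MM] >].

Definition mon_pow G k : {pred 'X_{1..n}} := iter k (mon_sum G) (pred1 0%MM).

Lemma mon_sumP G H m :
  reflect (exists g h, [/\ g \in G, h \in H & m = (g + h)%MM])
          (m \in mon_sum G H).
Proof. exact: asboolP. Qed.

(** Products of monomial ideals reduce to sumsets of exponent vectors, which
    moves the computation of powers entirely to the combinatorial side. *)
Lemma ideal_mul_mon G H :
  ideal_mul (mon_ideal G) (mon_ideal H) = mon_ideal (mon_sum G H).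
Proof.
apply: pred_ext => f; apply/idP/idP.
  move: f; apply: ideal_mul_ind => [|f g|a f g fG gH].
  - exact: ideal_gen0.
  - exact: ideal_genD.
  apply: ideal_genM; apply/mon_idealP => m.
  rewrite mcoeffM; apply: contra_neqP => noGH.
  rewrite big1 // => -[/= k1 k2] /eqP mE.
  case: (eqVneq f@_k1 0) => [->|f1]; first by rewrite mul0r.
  case: (eqVneq g@_k2 0) => [->|g1]; first by rewrite mulr0.
  have [u uG u1] := mon_ideal_mem fG f1.
  have [v vH v2] := mon_ideal_mem gH g1.
  case: noGH; exists (u + v)%MM; first by apply/mon_sumP; exists u, v.
  apply/mnm_lepP => a0; rewrite mE !mnmDE.
  by apply: leq_add; [move/mnm_lepP: u1 | move/mnm_lepP: v2].
move/ideal_genP=> [s sG ->]; rewrite big_seq; apply: ideal_gen_sum => p.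
move/sG/asboolP=> [_ /mon_sumP[u [v [uG vH ->]]] ->].
apply: ideal_genM; rewrite mpolyXD.
by apply: ideal_mulM; apply: mon_ideal_gen.
Qed.

Lemma ideal_pow_mon G k : ideal_pow (mon_ideal G) k = mon_ideal (mon_pow G k).
Proof.
elim: k => [|k IHk]; last by rewrite -ideal_mul_mon -IHk.
apply: pred_ext => f; rewrite [LHS]/=; symmetry; apply/mon_idealP => m _.
by exists 0%MM; [exact: eqxx | apply/mnm_lepP => i; rewrite mnm0E].
Qed.

Lemma mon_pow_mdeg G d k m :
  {in G, forall g, mdeg g = d} -> m \in mon_pow G k -> mdeg m = (k * d)%N.
Proof.
move=> Gd; elim: k m => [|k IHk] m; first by move/eqP->; rewrite mdeg0.
by move/mon_sumP=> [g [h [/Gd gd /IHk hd ->]]]; rewrite mdegD gd hd mulSn.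
Qed.

Lemma mon_pow_supp (V : pred 'I_n) G k m a :
  {in G, forall (g : 'X_{1..n}) b, ~~ V b -> g b = 0%N} ->
  m \in mon_pow G k -> ~~ V a -> m a = 0%N.
Proof.
move=> GV mG aV; elim: k m mG => [|k IHk] m; first by move/eqP->; rewrite mnm0E.
by move/mon_sumP=> [g [h [/GV g0 /IHk h0 ->]]]; rewrite mnmDE g0 ?h0.
Qed.

Lemma lepm_mdeg_eq (g m : 'X_{1..n}) :
  (g <= m)%MM -> mdeg g = mdeg m -> g = m.
Proof.
move=> gm gE; have /eqP := congr1 mdeg (submK gm).
rewrite mdegD gE -[X in _ == X]add0n eqn_add2r mdeg_eq0 => /eqP m0.
by rewrite -(submK gm) m0 add0m.
Qed.

(** Divisibility between monomials of the same degree is equality, so no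
    generator is redundant. *)
Lemma minimal_gens_mon_ideal G d :
  {in G, forall g, mdeg g = d} -> minimal_gens G (mon_ideal G).
Proof.
move=> Gd; split=> // H HG GH m; apply/idP/idP => [/HG //|mG].
have := mon_ideal_gen mG; rewrite GH => /mon_idealXP[h hH hm].
by rewrite -(lepm_mdeg_eq hm) // !Gd // HG.
Qed.

Lemma equigenerated_mon_ideal G d :
  {in G, forall g, mdeg g = d} -> equigenerated (mon_ideal G).
Proof.
by move=> Gd; exists G; [apply: minimal_gens_mon_ideal Gd | exists d].
Qed.

End MonomialIdeals.

Arguments mon_ideal K {n} G.

(** * The minimal number of generators *)

Section NumberOfGenerators.
Local Open Scope ring_scope.
Variables (K : fieldType) (n : nat).
Local Notation S := {mpoly K[n]}.

(** The lowest-degree part of a product only sees the constant term of the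
    cofactor; this is reduction modulo m I in coordinates. *)
Lemma mcoeffM_lowest (a f : S) (m : 'X_{1..n}) :
  (forall m', (mdeg m' < mdeg m)%N -> f@_m' = 0) ->
  (a * f)@_m = a@_0%MM * f@_m.
Proof.
move=> f0; rewrite -[a in LHS](subrK (a@_0)%:MP) mulrDl mcoeffD mcoeffCM.
rewrite -[RHS]add0r; congr (_ + _); rewrite mcoeffM big1 // => -[k1 k2] /eqP mE.
case: (eqVneq (k1 : 'X_{1..n}) 0%MM) => [k10|k10].
  by rewrite /= k10 mcoeffB mcoeffC eqxx mulr1 subrr mul0r.
rewrite [X in _ * X]f0 ?mulr0 // [X in (_ < X)%N](congr1 mdeg mE) mdegD /=.
by rewrite -[X in (X < _)%N]add0n ltn_add2r lt0n mdeg_eq0.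
Qed.

(** For an arbitrary, not necessarily monomial, system of generators, the
    vectors of its degree d coefficients span the coordinate space indexed by
    the monomial generators, so there are at least as many of them. *)
Lemma min_number_gens_mon (G : {pred 'X_{1..n}}) (L : seq 'X_{1..n}) d :
  uniq L -> L =i G -> {in G, forall g, mdeg g = d} ->
  min_number_gens (mon_ideal K G) (size L).
Proof.
move=> uL LG Gd; split.
  exists (map_tuple (fun u => 'X_[u]) (in_tuple L)) => f.
  rewrite /mon_ideal.
  suff -> : (fun f : S => `[< exists2 u, u \in G & f = 'X_[u] >]) =
      mem (map_tuple (fun u => 'X_[u]) (in_tuple L)) :> {pred S}.
    by [].
  apply: pred_ext => g; apply/asboolP/mapP => -[u uL' ->]; exists u => //.
    by rewrite /= LG.
  by rewrite -LG.
move=> r [t It].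
pose v (f : S) : 'rV[K]_(size L) := \row_c f@_(nth 0%MM L c).
have vL (c : 'I_(size L)) : nth 0%MM L c \in G by rewrite -LG mem_nth.
have vM a f : f \in mon_ideal K G -> v (a * f) = a@_0%MM *: v f.
  move=> fI; apply/rowP => c; rewrite !mxE mcoeffM_lowest // => m'.
  rewrite (Gd _ (vL c)); apply: contraTeq => /(mon_ideal_mem fI)[g /Gd gd gm].
  rewrite -leqNgt -gd -(submK gm) mdegD; exact: leq_addl.
have vD : {morph v : f g / f + g} by move=> f g; apply/rowP => c; rewrite !mxE mcoeffD.
have v0 : v 0 = 0 by apply/rowP => c; rewrite !mxE mcoeff0.
pose B : 'M[K]_(r, size L) := \matrix_(k < r) v (tnth t k).
suff : (1%:M <= B)%MS.
  by move/mxrankS; rewrite mxrank1 => /leq_trans; apply; apply: rank_leq_row.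
apply/row_subP => c; rewrite row1.
have -> : delta_mx 0 c = v 'X_[nth 0%MM L c].
  apply/rowP => c'; rewrite !mxE mcoeffX eqxx /= nth_uniq // eq_sym.
  by rewrite -val_eqE.
have := mon_ideal_gen K (vL c); rewrite It => /ideal_genP[s sT ->].
rewrite (big_morph v vD v0) big_seq.
apply: summx_sub => p /sT /= pt; rewrite vM; last by rewrite It; apply: ideal_gen1.
have /tnthP[k ->] := pt; apply: scalemx_sub.
by rewrite -(rowK (fun k => v (tnth t k))) row_sub.
Qed.

Lemma min_number_gens_uniq (R : comNzRingType) (I : {pred R}) r1 r2 :
  min_number_gens I r1 -> min_number_gens I r2 -> r1 = r2.
Proof.
by move=> [g1 m1] [g2 m2]; apply/eqP; rewrite eqn_leq m1 // m2.
Qed.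

End NumberOfGenerators.

(** * Monomials of bounded tail degree and principal Borel ideals *)

Section TailBounded.
Variables (n p q : nat).
Implicit Types (m g h : 'X_{1..n}) (a b : 'I_n).

Definition tail_deg m := \sum_(a < n | p <= a) m a.

(** For D = d and k = 1 these are the generators of B(x_p^(d-1) x_q); the
    variables with index at least p, counted from 0, form the tail. *)
Definition tail_bounded D k : {pred 'X_{1..n}} :=
  fun m => [&& mdeg m == D, [forall a : 'I_n, (q <= a) ==> (m a == 0)] &
               tail_deg m <= k].

Lemma tail_boundedP D k m :
  reflect [/\ mdeg m = D, forall a, q <= a -> m a = 0 & tail_deg m <= k]
          (m \in tail_bounded D k).
Proof.
apply: (iffP and3P) => -[/eqP mD m0 mk]; split=> //.
  by move=> a qa; move/forallP/(_ a): m0; rewrite qa => /eqP.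
by apply/forallP => a; apply/implyP => /m0 ->.
Qed.

Lemma tail_degD m1 m2 : tail_deg (m1 + m2)%MM = tail_deg m1 + tail_deg m2.
Proof. by rewrite /tail_deg -big_split; apply: eq_bigr => a _; rewrite mnmDE. Qed.

Lemma tail_degU a : tail_deg U_(a)%MM = (p <= a).
Proof.
rewrite /tail_deg; case: leqP => pa.
  rewrite (bigD1 a) //= mnm1E eqxx big1 // => b /andP[_ ba].
  by rewrite mnm1E eq_sym (negbTE ba).
rewrite big1 // => b pb; rewrite mnm1E; case: eqP => // ab.
by move: pa; rewrite ab ltnNge pb.
Qed.

Lemma tail_degMn m k : tail_deg (m *+ k)%MM = tail_deg m * k.
Proof. by rewrite /tail_deg big_distrl; apply: eq_bigr => a _; rewrite mulmnE. Qed.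

Definition head_part m := [multinom if a < p then m a else 0 | a < n].
Definition tail_part m := [multinom if a < p then 0 else m a | a < n].

Lemma head_tail_partK m : (head_part m + tail_part m)%MM = m.
Proof. by apply/mnmP => a; rewrite mnmDE !mnmE; case: ifP; rewrite ?addn0. Qed.

Lemma mdeg_tail_part m : mdeg (tail_part m) = tail_deg m.
Proof.
rewrite mdegE /tail_deg [RHS]big_mkcond /=; apply: eq_bigr => a _.
by rewrite mnmE ltnNge; case: leq.
Qed.

Lemma lepm_tail_deg m1 m2 : (m1 <= m2)%MM -> tail_deg m1 <= tail_deg m2.
Proof. by move=> /mnm_lepP le12; apply: leq_sum => a _. Qed.

Lemma tail_deg_head_part m : tail_deg (head_part m) = 0.
Proof. by rewrite /tail_deg big1 // => a pa; rewrite mnmE ltnNge pa. Qed.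

Lemma exists_lepm_mdeg m s : s <= mdeg m -> exists2 g, (g <= m)%MM & mdeg g = s.
Proof.
elim: s => [|s IHs] sm.
  by exists 0%MM; [apply/mnm_lepP => a; rewrite mnm0E | rewrite mdeg0].
have [g gm gs] := IHs (ltnW sm).
have [a ga|mg] := pickP (fun a => g a < m a).
  exists (g + U_(a))%MM; last by rewrite mdegD mdeg1 gs addn1.
  apply/mnm_lepP => b; rewrite mnmDE mnm1E; case: eqP => [<-|_].
    by rewrite addn1.
  by rewrite addn0; apply/mnm_lepP: b.
move: sm; rewrite -gs ltnNge !mdegE leq_sum // => a _.
by rewrite leqNgt mg.
Qed.

(** Give the first factor as much of the tail as it may carry and complete it
    with head variables; the condition k2 <= D2 guarantees that enough of them
    are available. *)
Lemma tail_bounded_sum D1 k1 D2 k2 : k2 <= D2 -> k1 <= D1 ->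
  mon_sum (tail_bounded D1 k1) (tail_bounded D2 k2) =i
  tail_bounded (D1 + D2) (k1 + k2).
Proof.
move=> kD2 kD1 m; apply/mon_sumP/tail_boundedP.
  move=> [g [h [/tail_boundedP[gD g0 gk] /tail_boundedP[hD h0 hk] ->]]].
  rewrite mdegD gD hD tail_degD leq_add //; split=> // a qa.
  by rewrite mnmDE g0 ?h0.
move=> [mD m0 mk].
have [t1 t1m t1D] := exists_lepm_mdeg (geq_minr k1 (mdeg (tail_part m))).
have mdegm : mdeg (head_part m) + tail_deg m = D1 + D2.
  by rewrite -mdeg_tail_part -mdegD head_tail_partK.
have : D1 - mdeg t1 <= mdeg (head_part m).
  by rewrite t1D mdeg_tail_part; lia.
case/exists_lepm_mdeg=> h1 h1m h1D.
have le1m : (h1 + t1 <= m)%MM.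
  rewrite -(head_tail_partK m); apply/mnm_lepP => a; rewrite !mnmDE.
  by apply: leq_add; [apply/mnm_lepP: a | apply/mnm_lepP: a].
have mE := submK le1m.
have mdeg1 : mdeg (h1 + t1)%MM = D1.
  rewrite mdegD h1D subnK // t1D; apply: leq_trans kD1; exact: geq_minl.
have th1 : tail_deg h1 = 0.
  by apply/eqP; rewrite -leqn0 -(tail_deg_head_part m) lepm_tail_deg.
have tt1 : tail_deg t1 = mdeg t1.
  rewrite mdegE (bigID (fun a : 'I_n => p <= a)) /= [X in _ + X]big1 ?addn0 //.
  move=> a; rewrite -ltnNge => ap; apply/eqP; rewrite -leqn0.
  by have /mnm_lepP/(_ a) := t1m; rewrite mnmE ap.
have t1E : tail_deg (h1 + t1)%MM = minn k1 (tail_deg m).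
  by rewrite tail_degD th1 tt1 t1D mdeg_tail_part.
exists (h1 + t1)%MM, (m - (h1 + t1))%MM; split; last by rewrite addmC mE.
  apply/tail_boundedP; split=> //; last by rewrite t1E geq_minl.
  move=> a qa; apply/eqP; rewrite -leqn0 -(m0 a qa).
  by have /mnm_lepP := le1m; apply.
apply/tail_boundedP; split.
- by apply: (@addIn D1); rewrite -{1}mdeg1 -mdegD mE mD addnC.
- by move=> a qa; rewrite mnmBE m0.
have : tail_deg (m - (h1 + t1))%MM + minn k1 (tail_deg m) = tail_deg m.
  by rewrite -t1E -tail_degD mE.
by move: mk; rewrite /minn; case: ifP; lia.
Qed.

Lemma mon_pow_tail_bounded d k : 0 < d ->
  mon_pow (tail_bounded d 1) k = tail_bounded (k * d) k.
Proof.
move=> d0; elim: k => [|k IHk].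
  apply: pred_ext => m; apply/eqP/tail_boundedP => [->|[/eqP]].
    by split=> [|a _|]; rewrite ?mdeg0 ?mnm0E // /tail_deg big1 // => a _; rewrite mnm0E.
  by rewrite mul0n mdeg_eq0 => /eqP.
rewrite [LHS]/= -/(mon_pow _ _) IHk; apply: pred_ext => m.
by rewrite tail_bounded_sum // leq_pmulr.
Qed.

End TailBounded.

Section PrincipalBorel.
Local Open Scope ring_scope.
Variables (K : fieldType) (n : nat).
Local Notation S := {mpoly K[n]}.

(** Strong stability is imposed on the minimal generators only; it passes to
    all monomials of J because x_b divides either a generator below the
    monomial or its cofactor. *)
Lemma strongly_stable_move (J : {pred S}) (w : 'X_{1..n}) (a b : 'I_n) :
  strongly_stable J -> (a <= b)%N ->
  'X_[w + U_(b)] \in J -> 'X_[w + U_(a)] \in J.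
Proof.
move=> [G [JG _] Gst]; rewrite leq_eqVlt => /orP[/eqP/val_inj -> //|ab].
have {}JG : J = mon_ideal K G by apply: pred_ext.
rewrite JG => /mon_idealXP[g gG gm].
have gle c := mnm_lepP gm c.
case: (posnP (g b)) => [gb0|gb].
  apply/mon_idealXP; exists g => //; apply/mnm_lepP => c; rewrite mnmDE.
  have := gle c; rewrite mnmDE mnm1E; case: eqP => [<-|_]; rewrite ?gb0 //.
  by rewrite addn0 => /leq_trans; apply; apply: leq_addr.
have bg : b \in supp g by rewrite inE lep1mP -lt0n.
have := Gst _ gG a b bg ab; rewrite JG => /mon_idealXP[h hG hm].
apply/mon_idealXP; exists h => //; apply: lepm_trans hm _; apply/mnm_lepP => c.
rewrite !mnmDE mnmBE; have := gle c; rewrite mnmDE.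
by move: gb; rewrite !mnm1E; case: (b =P c) => [<-|_] /=; lia.
Qed.

(** Replaces the factors x_i one at a time by the variables of h. *)
Lemma strongly_stable_head (J : {pred S}) (w h : 'X_{1..n}) (i : 'I_n) :
  strongly_stable J -> (forall a : 'I_n, (i < a)%N -> h a = 0%N) ->
  'X_[w + U_(i) *+ mdeg h] \in J -> 'X_[w + h] \in J.
Proof.
move=> Jst; move hd: (mdeg h) => d; elim: d => [|d IHd] in w h hd *.
  by move/eqP: hd; rewrite mdeg_eq0 => /eqP ->; rewrite mulm0n.
move=> h0 wJ; have [a ha] : exists a, (0 < h a)%N.
  apply/existsP; apply: contraT; rewrite negb_exists => /forallP hz.
  have : mdeg h = 0%N.
    by rewrite mdegE big1 // => a _; apply/eqP; rewrite -leqn0 leqNgt.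
  by rewrite hd.
have ai : (a <= i)%N by case: leqP => // /h0 ha0; rewrite ha0 in ha.
have hE : (h - U_(a) + U_(a))%MM = h by rewrite submK // lep1mP -lt0n.
rewrite -hE addmA; apply: (strongly_stable_move Jst ai).
rewrite -addmA [(_ + U_(i))%MM]addmC addmA; apply: IHd.
- by apply/eqP; rewrite -(eqn_add2r 1%N) -{1}(mdeg1 a) -mdegD hE hd addn1.
- by move=> b /h0; rewrite mnmBE => ->.
by rewrite -addmA -mulmS.
Qed.

Lemma strongly_stable_tail_bounded p q D k :
  strongly_stable (mon_ideal K (@tail_bounded n p q D k)).
Proof.
exists (tail_bounded p q D k).
  by apply: (@minimal_gens_mon_ideal _ _ _ D) => g /tail_boundedP[].
move=> u /tail_boundedP[uD u0 uk] a b; rewrite inE => bu ab.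
have uE := submK bu; apply: mon_ideal_gen; apply/tail_boundedP.
have ub : u b != 0%N by rewrite -lep1mP.
split.
- by rewrite mdegD mdeg1 -uD -{2}uE mdegD mdeg1 addnC.
- move=> c qc; rewrite mnmDE mnm1E mnmBE u0 // addn0; case: eqP => // ac.
  by rewrite u0 // in ub; apply: leq_trans (ltnW ab); rewrite ac.
apply: leq_trans uk; rewrite -[in X in (_ <= X)%N]uE !tail_degD !tail_degU.
rewrite addnC leq_add2l.
by case: (leqP p a) => // pa; rewrite (leq_trans pa (ltnW ab)).
Qed.

(** The ideal on the right is strongly stable and contains the monomial.
    Conversely each of its generators is h x_b with h in the head variables and
    b <= j: it is reached by moving x_j to x_b and the copies of x_i to the
    variables of h. *)
Lemma principal_borel_pow (i j : 'I_n) d : (i <= j)%N ->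
  principal_borel K (U_(i) *+ d + U_(j))%MM =
  mon_ideal K (tail_bounded i.+1 j.+1 d.+1 1).
Proof.
move=> ij; apply: pred_ext => f; apply/asboolP/idP => [|fI J Jst uJ].
  move=> /(_ _ (strongly_stable_tail_bounded i.+1 j.+1 d.+1 1)); apply.
  apply: mon_ideal_gen; apply/tail_boundedP; split.
  - by rewrite mdegD mdegMn !mdeg1 mul1n addn1.
  - move=> a ja; rewrite mnmDE mulmnE !mnm1E.
    by rewrite -!val_eqE /= (ltn_eqF ja) (ltn_eqF (leq_ltn_trans ij ja)).
  by rewrite tail_degD tail_degMn !tail_degU ltnn mul0n leq_b1.
case: (Jst) => G [JG _] _.
move: f fI; have {}JG : J = mon_ideal K G by apply: pred_ext.
move=> f /ideal_genP[s sG ->]; rewrite JG big_seq; apply: ideal_gen_sum => e /sG.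
move=> /asboolP[m mT ->]; apply: ideal_genM; rewrite -/(mon_ideal K G) -JG.
have : m \in mon_sum (tail_bounded i.+1 j.+1 d 0) (tail_bounded i.+1 j.+1 1 1).
  by rewrite tail_bounded_sum // !addn1.
move=> /mon_sumP[h [t [/tail_boundedP[hd _ ht] /tail_boundedP[td t0 _] ->]]].
have /eqP/mdeg1P[b /eqP tb] := td; rewrite {}tb {td} in t0 *.
have bj : (b <= j)%N.
  by rewrite leqNgt; apply/negP => /t0; rewrite mnm1E eqxx.
rewrite addmC; apply: (strongly_stable_head Jst (i := i)).
  move=> a ia; apply/eqP; rewrite -leqn0; apply: leq_trans ht.
  by rewrite /tail_deg (bigD1 a) //= leq_addr.
by rewrite addmC; apply: (strongly_stable_move Jst bj); rewrite hd.
Qed.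

End PrincipalBorel.

(** * Prime chains and algebraic dependence *)

Section PrimeChains.
Local Open Scope ring_scope.
Variables (A : comNzRingType).
Implicit Types (P : {pred A}).

Lemma idealr_closed_sum P (T : finType) (B : pred T) (F : T -> A) :
  idealr_closed P -> (forall t, B t -> F t \in P) -> \sum_(t | B t) F t \in P.
Proof.
move=> [P0 _ PD] FP; elim/big_ind: _ => // u v uP vP.
by have := PD 1 u v uP vP; rewrite mul1r.
Qed.

Lemma idealr_closedMl P a u : idealr_closed P -> u \in P -> a * u \in P.
Proof. by move=> [P0 _ PD] uP; have := PD a u 0 uP P0; rewrite addr0. Qed.

Lemma idealr_closed_addr P u v :
  idealr_closed P -> v \in P -> u + v \in P -> u \in P.
Proof.
move=> [P0 _ PD] vP uvP; have := PD (-1) v (u + v) vP uvP.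
by rewrite mulN1r addrC addrK.
Qed.

Lemma prime_idealXM P x k y :
  prime_ideal P -> x \notin P -> x ^+ k * y \in P -> y \in P.
Proof.
move=> [_ Pp] xP; elim: k => [|k IHk]; first by rewrite expr0 mul1r.
by rewrite exprS -mulrA => /Pp /orP[xP'|/IHk //]; rewrite xP' in xP.
Qed.

(** The Coquand-Lombardi argument.  Modulo the s-th prime, keep only the terms
    of the relation with lexicographically smallest exponents of x_0, ...,
    x_(s-1): the common power of x_s can be cancelled since x_s lies outside
    the s-th prime, and the terms still divisible by x_s vanish modulo the next
    prime.  At the top a single term remains, an invertible constant. *)
Lemma prime_chain_not_dependent e (P : 'I_e.+1 -> {pred A}) (x : 'I_e -> A) N
    (c : {ffun 'I_e -> 'I_N} -> A) (T : {set {ffun 'I_e -> 'I_N}}) :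
  prime_chain P ->
  (forall i, x i \in P (inord i.+1) /\ x i \notin P (inord i)) ->
  T != set0 -> {in T, forall a, exists b, b * c a = 1} ->
  \sum_(a in T) c a * \prod_i x i ^+ a i != 0.
Proof.
move=> [Pp Pch] xP T0 cT; apply/eqP => Tz.
have Pid i : idealr_closed (P i) by have [] := Pp i.
have step s : (s <= e)%N -> exists U : {set {ffun 'I_e -> 'I_N}},
    [/\ U != set0, U \subset T,
        {in U &, forall (a b : {ffun 'I_e -> 'I_N}) (i : 'I_e), (i < s)%N -> a i = b i} &
        \sum_(a in U) c a * \prod_(i < e | (s <= i)%N) x i ^+ a i
          \in P (inord s)].
  elim: s => [_|s IHs se].
    by exists T; split=> //; rewrite Tz; have [] := Pid (inord 0).
  have [U [/set0Pn[a0 a0U] UT Ueq UP]] := IHs (ltnW se).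
  pose i0 := Ordinal se.
  case: (@arg_minnP _ a0 (mem U) (fun a : {ffun 'I_e -> 'I_N} => a i0 : nat) a0U)
    => a1 a1U a1min.
  pose F (a : {ffun 'I_e -> 'I_N}) :=
    c a * \prod_(i < e | (s < i)%N) x i ^+ a i.
  have FE a : c a * \prod_(i < e | (s <= i)%N) x i ^+ a i = x i0 ^+ a i0 * F a.
    rewrite (bigD1 i0) //= mulrCA; congr (_ * (_ * _)).
    by apply: eq_bigl => i; rewrite [RHS]ltn_neqAle andbC -val_eqE eq_sym.
  exists [set a in U | a i0 == a1 i0]; split.
  - by apply/set0Pn; exists a1; rewrite inE eqxx andbT.
  - by apply/subsetP => a; rewrite inE => /andP[/(subsetP UT)].
  - move=> a b; rewrite !inE => /andP[aU /eqP ai] /andP[bU /eqP bi] i.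
    rewrite ltnS leq_eqVlt => /orP[/eqP ise|]; last exact: Ueq.
    by have -> : i = i0 by [exact: val_inj]; rewrite ai bi.
  have [xs xs'] := xP i0.
  have UE : \sum_(a in U) c a * \prod_(i < e | (s <= i)%N) x i ^+ a i =
      x i0 ^+ a1 i0 * \sum_(a in U) x i0 ^+ (a i0 - a1 i0) * F a.
    rewrite mulr_sumr; apply: eq_bigr => a aU.
    by rewrite FE mulrA -exprD subnKC // a1min.
  move: UP; rewrite UE => /(prime_idealXM (Pp _) xs') UP.
  have ss : ((inord s : 'I_e.+1) < (inord s.+1 : 'I_e.+1))%N.
    by rewrite !inordK // ltnW.
  have {}UP := (Pch _ _ ss).1 _ UP.
  rewrite (bigID (fun a : {ffun 'I_e -> 'I_N} => a i0 == a1 i0)) /= in UP.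
  have rest : \sum_(a in U | a i0 != a1 i0) x i0 ^+ (a i0 - a1 i0) * F a
      \in P (inord s.+1).
    apply: idealr_closed_sum => // a /andP[aU aN].
    have : (0 < a i0 - a1 i0)%N.
      by rewrite subn_gt0 ltn_neqAle a1min // andbT eq_sym.
    case: (_ - _)%N => // k _; rewrite exprS -mulrA mulrC.
    exact: idealr_closedMl.
  rewrite [X in X \in _](_ : _ = \sum_(a in U | a i0 == a1 i0)
      x i0 ^+ (a i0 - a1 i0) * F a); first exact: idealr_closed_addr rest UP.
  apply: eq_big => [a|a]; first by rewrite inE.
  by rewrite inE => /andP[_ /eqP ->]; rewrite subnn expr0 mul1r.
have [U [/set0Pn[a aU] UT Ueq]] := step e (leqnn e).
have -> : U = [set a].
  apply/setP => b; rewrite inE; apply/idP/eqP => [bU|-> //].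
  by apply/ffunP => i; apply: Ueq => //.
rewrite big_set1 big1 ?mulr1; last by move=> i; rewrite leqNgt ltn_ord.
have [b bc] := cT a (subsetP UT _ aU).
move/(idealr_closedMl b (Pid _)); rewrite bc.
by have [_ /negP] := Pid (inord e).
Qed.

Lemma prime_chain_elements e (P : 'I_e.+1 -> {pred A}) : prime_chain P ->
  exists x : 'I_e -> A,
    forall i, x i \in P (inord i.+1) /\ x i \notin P (inord i).
Proof.
move=> [_ Pch].
suff /choice[x xP] : forall i : 'I_e, exists y,
  y \in P (inord i.+1) /\ y \notin P (inord i) by exists x.
move=> i; have ii : ((inord i : 'I_e.+1) < (inord i.+1 : 'I_e.+1))%N.
  by rewrite !inordK // ltnS // ltnW.
have [_ nsub] := Pch _ _ ii; apply: contrapT => ny.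
apply: nsub => y yP; apply: contrapT => /negP yN.
by apply: ny; exists y.
Qed.

End PrimeChains.

(** * Linear relations, homogeneous parts and face weights *)

Section LinearDependence.
Local Open Scope ring_scope.

Lemma exists_linear_relation (K : fieldType) (T B : finType) (M : T -> B -> K) :
  (#|B| < #|T|)%N ->
  exists2 c : T -> K, exists t, c t != 0 & forall b, \sum_t c t * M t b = 0.
Proof.
move=> BT.
pose A : 'M[K]_(#|T|, #|B|) := \matrix_(i, j) M (enum_val i) (enum_val j).
have /rowV0Pn[v /sub_kermxP vA v0] : kermx A != 0.
  by rewrite kermx_eq0 /row_free neq_ltn (leq_ltn_trans (rank_leq_col A) BT).
exists (fun t => v 0 (enum_rank t)).
  have [i vi] : exists i, v 0 i != 0.
    apply/existsP; apply: contraR v0 => /existsPn v0.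
    by apply/eqP/rowP => i; rewrite mxE; apply/eqP; rewrite -[_ == _]negbK v0.
  by exists (enum_val i); rewrite enum_valK.
move=> b; have /matrixP/(_ 0 (enum_rank b)) := vA; rewrite !mxE => {2}<-.
rewrite (reindex (@enum_val T T)) /=; last by apply: onW_bij; apply: enum_val_bij.
by apply: eq_bigr => i _; rewrite enum_valK mxE enum_rankK.
Qed.

Lemma size_prod_exp_leq (R : nzRingType) e (F : 'I_e -> {poly R}) (a : 'I_e -> nat) D :
  (forall i, size (F i) <= D)%N ->
  (size (\prod_i F i ^+ a i)%R <= (\sum_i a i * D).+1)%N.
Proof.
move=> FD; elim/big_rec2: _ => [|i s p _ IH]; first by rewrite size_poly1.
have := size_polyMleq (F i ^+ a i) p; have := size_poly_exp_leq (F i) (a i).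
have : ((size (F i)).-1 * a i <= a i * D)%N.
  by rewrite mulnC leq_mul2l (leq_trans (leq_pred _) (FD i)) orbT.
by move: IH; lia.
Qed.

End LinearDependence.

Section HomogeneousPart.
Local Open Scope ring_scope.
Variables (R : nzRingType) (n : nat) (w : measure n).
Implicit Types (f g : {mpoly R[n]}) (m : 'X_{1..n}).

Lemma mcoeff_pihomog d f m :
  (pihomog w d f)@_m = if w m == d then f@_m else 0.
Proof.
rewrite pihomogE raddf_sum /= big_mkcond /=.
under eq_bigr => m' _.
  rewrite (_ : (if _ then _ else _) = if m' == m then
     (if w m == d then f@_m else 0) else 0); first over.
  case: (eqVneq m' m) => [->|m'm]; first by rewrite mcoeffZ mcoeffX eqxx mulr1.
  by rewrite mcoeffZ mcoeffX (negbTE m'm) mulr0 if_same.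
have [mf|mf] := boolP (m \in msupp f).
  rewrite (bigD1_seq m) ?msupp_uniq //= eqxx big1 ?addr0 //.
  by move=> m' /negbTE ->.
rewrite big_seq big1.
  by rewrite (memN_msupp_eq0 mf) if_same.
by move=> m' m'f; case: eqP => // m'm; rewrite m'm (negbTE mf) in m'f.
Qed.

(** A term of the product has weight s + t only if its factors have weights
    exactly s and t, since neither can have less. *)
Lemma pihomogM_lowest s t f g :
  (forall m, f@_m != 0 -> (s <= w m)%N) -> (forall m, g@_m != 0 -> (t <= w m)%N) ->
  pihomog w (s + t) (f * g) = pihomog w s f * pihomog w t g.
Proof.
move=> fs gt; apply/mpolyP => m; rewrite mcoeff_pihomog !mcoeffM.
case: eqP => wm; last first.
  rewrite big1 // => -[k1 k2] /= /eqP mE; rewrite !mcoeff_pihomog.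
  case: eqP => w1; last by rewrite mul0r.
  case: eqP => w2; last by rewrite mulr0.
  by case: wm; rewrite mE mfD w1 w2.
apply: eq_bigr => -[k1 k2] /= /eqP mE; rewrite !mcoeff_pihomog.
case: (eqVneq f@_k1 0) => [->|f1]; first by rewrite if_same !mul0r.
case: (eqVneq g@_k2 0) => [->|g2]; first by rewrite if_same !mulr0.
move: wm (fs _ f1) (gt _ g2); rewrite [X in w X]mE mfD => w12 w1 w2.
have [-> ->] : w k1 = s /\ w k2 = t by lia.
by rewrite !eqxx.
Qed.

End HomogeneousPart.

Section FaceWeight.
Variables (n : nat) (W : pred 'I_n).

(** Elements of I^t have weight at least t d, and their weight t d part
    consists of the terms that have degree t d and are free of the variables in
    W.  So the initial form for this single weight performs at once the
    reduction to the fiber cone and the substitution of 0 for the variables in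
    W. *)
Definition face_weight (m : 'X_{1..n}) := mdeg m + \sum_(a | W a) m a.

Lemma face_weight0 : face_weight 0%MM = 0.
Proof. by rewrite /face_weight mdeg0 big1 // => a _; rewrite mnm0E. Qed.

Lemma face_weightD :
  {morph face_weight : m1 m2 / (m1 + m2)%MM >-> (m1 + m2)%N}.
Proof.
move=> m1 m2; rewrite /face_weight mdegD addnACA -big_split; congr (_ + _).
by apply: eq_bigr => a _; rewrite mnmDE.
Qed.

HB.instance Definition _ := isMeasure.Build n face_weight face_weight0 face_weightD.

Lemma face_weightU a : face_weight U_(a)%MM = (W a).+1.
Proof.
rewrite /face_weight mdeg1; congr S; case: (boolP (W a)) => Wa.
  rewrite (bigD1 a) //= mnm1E eqxx big1 // => b /andP[_ ba].
  by rewrite mnm1E eq_sym (negbTE ba).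
rewrite big1 // => b Wb; rewrite mnm1E; case: eqP => // ab.
by rewrite ab Wb in Wa.
Qed.

End FaceWeight.

Lemma face_weight_sub n (W W' : pred 'I_n) m :
  subpred W W' -> face_weight W m <= face_weight W' m.
Proof.
move=> WW'; rewrite leq_add2l big_mkcond [X in _ <= X]big_mkcond /=.
by apply: leq_sum => a _; case: ifP => // /WW' ->.
Qed.

(** * The upper bound for the dimension of the fiber cone *)

Section FiberCone.
Local Open Scope ring_scope.
Local Open Scope quotient_scope.
Variables (K : fieldType) (n : nat) (G : {pred 'X_{1..n}}) (d : nat).
Hypothesis Gd : {in G, forall g, mdeg g = d}.
Local Notation S := {mpoly K[n]}.
Local Notation I := (mon_ideal K G).
Local Notation FI := (@fiber_ideal K n (mon_ideal K G)).

Definition fiber_proj (r : rees I) : fiber_cone I :=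
  \pi_{ideal_quot FI} r.

HB.instance Definition _ := GRing.RMorphism.copy fiber_proj
  (\pi_{ideal_quot FI} : rees I -> fiber_cone I).

Lemma rees_coef (r : rees I) t : (val r)`_t \in mon_ideal K (mon_pow G t).
Proof. by rewrite -ideal_pow_mon; have /asboolP := valP r. Qed.

Lemma rees_coef_mdeg (r : rees I) t m :
  (val r)`_t@_m != 0 -> (t * d <= mdeg m)%N.
Proof.
move/(mon_ideal_mem (rees_coef r t))=> [g gG gm].
by rewrite -(mon_pow_mdeg Gd gG) -(submK gm) mdegD leq_addl.
Qed.

(** Together with the next lemma: an element of the Rees algebra dies in the
    fiber cone exactly when each coefficient of t^k has no terms of degree
    k d. *)
Lemma fiber_ideal_coef (r : rees I) t m : r \in FI ->
  (val r)`_t@_m != 0 -> (t * d < mdeg m)%N.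
Proof.
move=> /asboolP/(_ t); rewrite ideal_pow_mon => rt; apply: contra_neqT.
rewrite -leqNgt; move: (_`_t) rt => f.
move: f; apply: ideal_mul_ind => [|f g f0 g0 md|a f g fm gG md].
- by rewrite mcoeff0.
- by rewrite mcoeffD f0 // g0 // addr0.
have low m' : (mdeg m' <= t * d)%N -> (f * g)@_m' = 0.
  move=> md'; rewrite mcoeffM big1 // => -[k1 k2] /= /eqP mE.
  case: (eqVneq (k1 : 'X_{1..n}) 0%MM) => [->|k10].
    by rewrite max_ideal_coef0 // mul0r.
  case: (eqVneq g@_k2 0) => [->|g2]; first by rewrite mulr0.
  have [h hG hk] := mon_ideal_mem gG g2.
  move: md'; rewrite [X in (mdeg X <= _)%N]mE mdegD.
  have := congr1 mdeg (submK hk); rewrite mdegD (mon_pow_mdeg Gd hG).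
  by move: k10; rewrite -mdeg_eq0; lia.
rewrite mcoeffM big1 // => -[k1 k2] /= /eqP mE.
rewrite [X in _ * X]low ?mulr0 //.
by apply: leq_trans md; rewrite [X in (_ <= mdeg X)%N]mE mdegD leq_addl.
Qed.

Lemma fiber_idealP (r : rees I) :
  (forall t m, mdeg m = (t * d)%N -> (val r)`_t@_m = 0) ->
  r \in FI.
Proof.
move=> r0; apply/asboolP => t; rewrite ideal_pow_mon.
rewrite [(val r)`_t]mpolyE big_seq; apply: ideal_gen_sum => m.
rewrite mcoeff_msupp => rm.
have [g gG gm] := mon_ideal_mem (rees_coef r t) rm.
have : mdeg (m - g)%MM != 0%N.
  apply: contra_neq rm => /eqP; rewrite mdeg_eq0 => /eqP mg.
  by rewrite r0 // -(submK gm) mg add0m (mon_pow_mdeg Gd gG).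
rewrite mdeg_eq0 => mg0.
have [a ma] : exists a, (m - g)%MM a != 0%N.
  apply/existsP; apply: contraR mg0 => /existsPn mg0.
  by apply/eqP/mnmP => a; rewrite mnm0E; apply/eqP; rewrite -[_ == _]negbK mg0.
have am : (U_(a) <= m - g)%MM by rewrite lep1mP.
rewrite -mul_mpolyC -(submK gm) -(submK am) !mpolyXD -!mulrA.
do 2 apply: ideal_genM; apply: ideal_mulM; last exact: mon_ideal_gen.
by apply: ideal_gen1; apply/asboolP; exists a.
Qed.

Section UpperBound.
Hypothesis d_gt0 : (0 < d)%N.
Variable V : pred 'I_n.
Hypothesis GV : {in G, forall (g : 'X_{1..n}) a, ~~ V a -> g a = 0%N}.

Lemma const_in_rees (c : K) : (c%:MP)%:P \in rees_pred I.
Proof.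
apply/asboolP => t; rewrite coefC; case: eqP => [-> //|_].
exact: ideal_pow0.
Qed.

Definition rees_const c : rees I := Rees (const_in_rees c).

Lemma rees_constM c c' : rees_const (c * c') = rees_const c * rees_const c'.
Proof. by apply: val_inj; rewrite rmorphM /= !rmorphM. Qed.

Lemma rees_const1 : rees_const 1 = 1.
Proof. by apply: val_inj; rewrite rmorph1 /= !rmorph1. Qed.

Lemma rees_coef_supp (r : rees I) t m a :
  mdeg m = (t * d)%N -> (val r)`_t@_m != 0 -> ~~ V a -> m a = 0%N.
Proof.
move=> md /(mon_ideal_mem (rees_coef r t))[g gG gm].
rewrite -(lepm_mdeg_eq gm); first exact: (mon_pow_supp (V := V)) GV gG.
by rewrite md (mon_pow_mdeg Gd gG).
Qed.

(** Compare dimensions: there are N^e power products with exponents below N,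
    and up to the fiber ideal each is determined by coefficients of monomials in
    the q = #|V| variables whose exponents are at most e N D d, where D bounds
    the degrees of the r i in the Rees variable.  That makes at most
    ((e D d + 1) N)^q coefficients, fewer than N^e for large N since q < e. *)
Lemma rees_monomials_dependent e (r : 'I_e -> rees I) : (#|V| < e)%N ->
  exists N (c : {ffun 'I_e -> 'I_N} -> K), (exists a, c a != 0) /\
    \sum_a rees_const (c a) * \prod_i r i ^+ a i \in FI.
Proof.
move=> Ve; pose D := (\max_i size (val (r i)))%N.
pose N := ((e * D * d).+1 ^ #|V|).+1.
pose B := {ffun {a : 'I_n | V a} -> 'I_(e * N * D * d).+1}.
pose mon (b : B) := [multinom (if insub a is Some a' then b a' : nat else 0%N) | a < n].
pose M (a : {ffun 'I_e -> 'I_N}) (b : B) : K :=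
  (val (\prod_i r i ^+ a i))`_(mdeg (mon b) %/ d)@_(mon b).
have card : (#|B| < #|{ffun 'I_e -> 'I_N}|)%N.
  rewrite !card_ffun card_sig !card_ord.
  have NE : ((e * N * D * d).+1 <= (e * D * d).+1 * N)%N by nia.
  apply: (@leq_ltn_trans (((e * D * d).+1 * N) ^ #|V|)).
    by case: #|V| => // q'; rewrite leq_exp2r.
  rewrite expnMn; apply: (@leq_trans (N ^ #|V|.+1)).
    by rewrite expnS ltn_mul2r expn_gt0 /= ltnS.
  by rewrite leq_exp2l // ltnS expn_gt0.
have [c c0 cM] := exists_linear_relation M card.
exists N, c; split=> //; apply: fiber_idealP => t m md.
rewrite rmorph_sum coef_sum raddf_sum /=.
have cE a : (val (rees_const (c a) * \prod_i r i ^+ a i))`_t@_m =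
    c a * (val (\prod_i r i ^+ a i))`_t@_m.
  by rewrite rmorphM coefCM mcoeffCM.
under eq_bigr => a _ do rewrite cE.
have [/forallP z|] := boolP [forall a : {ffun 'I_e -> 'I_N},
    (val (\prod_i r i ^+ a i))`_t@_m == 0].
  by rewrite big1 // => a _; rewrite (eqP (z a)) mulr0.
rewrite negb_forall => /existsP[a am].
have tle : (t <= e * N * D)%N.
  have : (t < size (val (\prod_i r i ^+ a i)%R))%N.
    by rewrite ltnNge; apply: contra am => /leq_sizeP/(_ t) -> //; rewrite mcoeff0.
  rewrite rmorph_prod (eq_bigr _ (fun i _ => rmorphXn _ _ _)).
  move/leq_trans => /(_ (\sum_i a i * D)%N.+1) tl.
  have {}tl : (t <= (\sum_i a i * D)%N)%N.
    by apply: tl; apply: size_prod_exp_leq => i; apply: leq_bigmax.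
  apply: leq_trans tl _; rewrite -mulnA -[X in (_ <= X * _)%N]card_ord -sum_nat_const.
  by apply: leq_sum => i _; rewrite leq_mul2r ltnW ?orbT.
pose b : B := [ffun a' => inord (m (val a'))].
have mb : mon b = m.
  apply/mnmP => a'; rewrite mnmE; case: insubP => [a'' _ <-|Va].
    rewrite ffunE inordK // ltnS; apply: (@leq_trans (mdeg m)).
      by rewrite mdegE (bigD1 (val a'')) //= leq_addr.
    by rewrite md leq_mul2r tle orbT.
  by rewrite (rees_coef_supp md am Va).
have := cM b; rewrite /M mb md mulnK //.
Qed.

Lemma prime_chain_fiber_cone_leq e (P : 'I_e.+1 -> {pred fiber_cone I}) :
  prime_chain P -> (e <= #|V|)%N.
Proof.
move=> Pch; rewrite leqNgt; apply/negP => Ve.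
have [x xP] := prime_chain_elements Pch.
have [N [c [[a0 ca0] cr]]] := rees_monomials_dependent (fun i => repr (x i)) Ve.
pose T := [set a | c a != 0].
have := prime_chain_not_dependent (T := T)
  (c := fun a => fiber_proj (rees_const (c a))) Pch xP.
move=> /(_ _ _)/negP; apply.
- by apply/set0Pn; exists a0; rewrite inE.
- move=> a; rewrite inE => ca; exists (fiber_proj (rees_const (c a)^-1)).
  by rewrite -rmorphM -rees_constM mulVf // rees_const1 rmorph1.
have : fiber_proj (\sum_a rees_const (c a) * \prod_i repr (x i) ^+ a i) = 0.
  apply/eqP; rewrite -(rmorph0 fiber_proj) /fiber_proj -Quotient.idealrBE subr0.
  exact: cr.
rewrite rmorph_sum (bigID (mem T)) /= [X in _ + X]big1 ?addr0 => [z|a].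
  apply/eqP; rewrite -[RHS]z; apply: eq_bigr => a _.
  rewrite rmorphM rmorph_prod; congr (_ * _).
  by apply: eq_bigr => i _; rewrite rmorphXn /= /fiber_proj reprK.
rewrite inE negbK => /eqP ->; rewrite [X in fiber_proj X](_ : _ = 0) ?rmorph0 //.
by apply: val_inj; rewrite rmorphM /= mpolyC0 mul0r.
Qed.

End UpperBound.

End FiberCone.

(** * The lower bound for the dimension of the fiber cone *)

Section FacePrimes.
Local Open Scope ring_scope.
Local Open Scope quotient_scope.
Variables (K : fieldType) (n : nat) (G : {pred 'X_{1..n}}) (d : nat).
Hypothesis Gd : {in G, forall g, mdeg g = d}.
Local Notation S := {mpoly K[n]}.
Local Notation I := (mon_ideal K G).
Local Notation FI := (@fiber_ideal K n (mon_ideal K G)).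

Section Face.
Variable W : pred 'I_n.
Local Notation w := (face_weight W).

Definition initial_form (p : {poly S}) : {poly S} :=
  \poly_(t < size p) pihomog w (t * d) p`_t.

Lemma coef_initial_form p t : (initial_form p)`_t = pihomog w (t * d) p`_t.
Proof.
rewrite coef_poly; case: ltnP => // /(nth_default 0) ->.
by rewrite pihomog0.
Qed.

Lemma initial_formB : {morph initial_form : p q / p - q}.
Proof.
by move=> p q; apply/polyP => t; rewrite coefB !coef_initial_form coefB pihomogB.
Qed.

Lemma initial_formD : {morph initial_form : p q / p + q}.
Proof.
by move=> p q; apply/polyP => t; rewrite coefD !coef_initial_form coefD pihomogD.
Qed.

Lemma initial_form1 : initial_form 1 = 1.
Proof.
apply/polyP => t; rewrite coef_initial_form coef1.
case: t => [|t] /=; last by rewrite pihomog0.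
by rewrite -mpolyX0 pihomogX /= face_weight0 mul0n eqxx.
Qed.

Lemma initial_form_eq0P (p : {poly S}) :
  reflect (forall t m, w m = (t * d)%N -> p`_t@_m = 0) (initial_form p == 0).
Proof.
apply: (iffP eqP) => [p0 t m wm|p0].
  have := congr1 (fun f : {poly S} => f`_t@_m) p0.
  by rewrite coef_initial_form coef0 mcoeff0 mcoeff_pihomog /= wm eqxx.
apply/polyP => t; rewrite coef_initial_form coef0; apply/mpolyP => m.
by rewrite mcoeff_pihomog mcoeff0; case: eqP => // /p0.
Qed.

Lemma rees_coef_face_weight (r : rees I) t m :
  (val r)`_t@_m != 0 -> (t * d <= w m)%N.
Proof. by move/(rees_coef_mdeg Gd)/leq_trans; apply; apply: leq_addr. Qed.

(** Multiplicativity needs both factors in the Rees algebra: it fails for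
    polynomials with coefficients of too small weight. *)
Lemma initial_formM (r s : rees I) :
  initial_form (val r * val s) = initial_form (val r) * initial_form (val s).
Proof.
apply/polyP => t; rewrite coef_initial_form !coefM raddf_sum /=.
apply: eq_bigr => i _; rewrite !coef_initial_form.
have {1}-> : (t * d)%N = (i * d + (t - i) * d)%N.
  by rewrite -mulnDl subnKC // -ltnS.
by apply: pihomogM_lowest => m; apply: rees_coef_face_weight.
Qed.

Lemma initial_form_fiber_ideal r : r \in FI -> initial_form (val r) = 0.
Proof.
move=> rI; apply/eqP/initial_form_eq0P => t m wm; apply/eqP; apply: contraT.
move/(fiber_ideal_coef Gd rI)/leq_trans/(_ (leq_addr (\sum_(a | W a) m a) _)).
by rewrite -/(face_weight W m) wm ltnn.
Qed.

Lemma initial_form_repr (r : rees I) :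
  initial_form (val (repr (fiber_proj r))) = initial_form (val r).
Proof.
apply/eqP; rewrite -subr_eq0 -initial_formB -rmorphB initial_form_fiber_ideal //.
by rewrite Quotient.idealrBE; apply/eqP; apply: (reprK (fiber_proj r)).
Qed.

(** The kernel of the initial form, a ring morphism from the Rees algebra to a
    domain that kills the fiber ideal, viewed inside the fiber cone. *)
Definition face_prime : {pred fiber_cone I} :=
  fun x => initial_form (val (repr x)) == 0.

Lemma fiber_proj_surj (x : fiber_cone I) : exists r, x = fiber_proj r.
Proof. by exists (repr x); rewrite /fiber_proj reprK. Qed.

Lemma mem_face_prime r : (fiber_proj r \in face_prime) = (initial_form (val r) == 0).
Proof. by rewrite -initial_form_repr. Qed.

Lemma face_prime_ideal : prime_ideal face_prime.
Proof.
split.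
  split.
  - by rewrite -(rmorph0 (@fiber_proj K n G)) mem_face_prime
      initial_form_fiber_ideal // idealr0.
  - rewrite -(rmorph1 (@fiber_proj K n G)) mem_face_prime rmorph1 initial_form1.
    exact: oner_neq0.
  move=> a u v; have [{}a ->] := fiber_proj_surj a.
  have [{}u ->] := fiber_proj_surj u; have [{}v ->] := fiber_proj_surj v.
  rewrite -rmorphM -rmorphD !mem_face_prime rmorphD rmorphM => /eqP u0 /eqP v0.
  by rewrite initial_formD initial_formM u0 v0 mulr0 addr0.
move=> u v; have [{}u ->] := fiber_proj_surj u; have [{}v ->] := fiber_proj_surj v.
by rewrite -rmorphM !mem_face_prime rmorphM initial_formM mulf_eq0.
Qed.

Lemma gen_in_rees g : g \in G -> 'X_[g]%:P * 'X \in rees_pred I.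
Proof.
move=> gG; apply/asboolP => t; rewrite coefMX coefC.
case: t => [|[|t]] //=; last exact: (ideal_pow0 _ t.+2).
rewrite -['X_[g]]mulr1; apply: ideal_mulM => //; exact: mon_ideal_gen.
Qed.

Lemma mem_face_prime_gen g (gG : g \in G) :
  (fiber_proj (Rees (gen_in_rees gG)) \in face_prime) = (w g != d).
Proof.
rewrite mem_face_prime /=; apply/initial_form_eq0P/idP => [/(_ 1%N g)|wg t m wm].
  rewrite mul1n coefMX coefC /= mcoeffX eqxx => g0; apply/eqP => /g0 /eqP.
  by rewrite oner_eq0.
rewrite coefMX coefC; case: t wm => [|[|t]] //=; rewrite ?mcoeff0 // mul1n => wm.
by rewrite mcoeffX; case: eqP => // gm; rewrite gm wm eqxx in wg.
Qed.

End Face.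

Lemma face_prime_sub (W W' : pred 'I_n) :
  subpred W W' -> {subset face_prime W <= face_prime W'}.
Proof.
move=> WW' x /initial_form_eq0P xW; apply/initial_form_eq0P => t m wm.
apply/eqP; apply: contraTT isT => xm.
have := face_weight_sub m WW'; have := rees_coef_face_weight W xm.
by rewrite wm => w1 w2; rewrite xW ?eqxx in xm; last by apply/eqP; rewrite eqn_leq w1 w2.
Qed.

End FacePrimes.

(** * The analytic spread *)

Lemma card_ord_lt n q : q <= n -> #|[pred a : 'I_n | a < q]| = q.
Proof.
move=> qn; rewrite -sum1_card -(big_ord_widen n (fun=> 1) qn).
by rewrite sum1_card card_ord.
Qed.

Section AnalyticSpread.
Local Open Scope ring_scope.
Variables (K : fieldType) (n : nat).

Lemma analytic_spread_mon (G : {pred 'X_{1..n}}) d (q : nat) (o : 'I_n) :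
  {in G, forall g, mdeg g = d.+1} -> (q <= n)%N -> (o < q)%N -> o = 0%N :> nat ->
  {in G, forall (g : 'X_{1..n}) (a : 'I_n), (q <= a)%N -> g a = 0%N} ->
  (forall a : 'I_n, (a < q)%N -> (U_(o) *+ d + U_(a))%MM \in G) ->
  analytic_spread (mon_ideal K G) q.
Proof.
move=> Gd qn oq o0 GV Gx; split; last first.
  move=> e P /(prime_chain_fiber_cone_leq Gd (ltn0Sn d)).
  move/(_ [pred a : 'I_n | (a < q)%N]); rewrite card_ord_lt //; apply.
  by move=> g gG a; rewrite inE -leqNgt; apply: GV.
(* The k-th prime kills the last k of the first q variables, and, without
   effect on I, all variables from q on. *)
pose W (k : 'I_q.+1) : pred 'I_n := fun a => (q - k <= a)%N.
exists (fun k => @face_prime K n G d.+1 (W k)); split=> [k|k l kl].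
  exact: face_prime_ideal Gd _.
have WW : subpred (W k) (W l).
  by move=> a; apply: leq_trans; apply: leq_sub2l; apply: ltnW.
split; first exact: face_prime_sub Gd _ _ WW.
have kq : (k < q)%N by apply: leq_trans kl _; rewrite -ltnS.
(* The variable with index q - k - 1 is killed by the l-th prime, not by the
   k-th one. *)
have an : ((q - k).-1 < n)%N by lia.
have aq : (Ordinal an < q)%N by rewrite /=; lia.
have fw j : face_weight (W j) (U_(o) *+ d + U_(Ordinal an))%MM =
    (d * (W j o).+1 + (W j (Ordinal an)).+1)%N.
  rewrite face_weightD face_weightU; congr (_ + _)%N.
  elim: (d) => [|d' IHd]; first by rewrite mulm0n face_weight0 mul0n.
  by rewrite mulmS face_weightD IHd face_weightU mulSn.
have Wk : W k o = false /\ W k (Ordinal an) = false.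
  by rewrite /W /= o0; split; apply/negbTE; lia.
have Wl : W l (Ordinal an) by rewrite /W /=; lia.
move=> /(_ (fiber_proj (Rees (gen_in_rees K (Gx _ aq))))).
rewrite !(mem_face_prime_gen K Gd) !fw Wl Wk.1 Wk.2 muln1 addn1 eqxx /= => H.
by suff : false by []; apply: H; lia.
Qed.

End AnalyticSpread.

(** * Counting monomials *)

Section Counting.
Variable n : nat.
Implicit Types (m : 'X_{1..n}) (vs : seq 'I_n).

(** The two cases, divisible by v or free of v, reproduce Pascal's rule. *)
Fixpoint monomials vs : nat -> seq 'X_{1..n} :=
  if vs is v :: vs' then
    fix aux D := if D is D'.+1
      then [seq (U_(v) + m)%MM | m <- aux D'] ++ monomials vs' D
      else monomials vs' 0
  else fun D => nseq (D == 0) 0%MM.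

Lemma monomialsP vs D m :
  reflect (mdeg m = D /\ forall a, a \notin vs -> m a = 0) (m \in monomials vs D).
Proof.
elim: vs D m => [|v vs IHvs] D m.
  rewrite mem_nseq lt0b; apply: (iffP andP) => [[/eqP-> /eqP->]|[<- m0]].
    by rewrite mdeg0; split=> // a; rewrite mnm0E.
  have -> : m = 0%MM by apply/mnmP => a; rewrite m0 // mnm0E.
  by rewrite mdeg0.
elim: D m => [|D IHD] m.
  apply: (iffP (IHvs 0 m)) => -[md m0]; split=> // a.
    by rewrite inE negb_or => /andP[_ /m0].
  by move: md => /eqP; rewrite mdeg_eq0 => /eqP ->; rewrite mnm0E.
rewrite mem_cat; apply: (iffP orP) => [[/mapP[m' /IHD[md m0] ->]|/IHvs[md m0]]|[md m0]].
- rewrite mdegD mdeg1 md; split=> // a; rewrite inE negb_or => /andP[av avs].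
  by rewrite mnmDE mnm1E eq_sym (negbTE av) m0 // inE negb_or av.
- by split=> // a; rewrite inE negb_or => /andP[_ /m0].
case: (posnP (m v)) => [mv|mv]; [right|left].
  apply/IHvs; split=> // a avs; case: (eqVneq a v) => [-> //|av].
  by apply: m0; rewrite inE negb_or av.
have vm : (U_(v) <= m)%MM by rewrite lep1mP -lt0n.
have mE := submK vm.
apply/mapP; exists (m - U_(v))%MM; last by rewrite addmC mE.
apply/IHD; split=> [|a avs]; last by rewrite mnmBE m0.
by apply/eqP; rewrite -(eqn_add2r 1) -{1}(mdeg1 v) -mdegD mE md addn1.
Qed.

Lemma monomials_uniq vs D : uniq vs -> uniq (monomials vs D).
Proof.
elim: vs D => [|v vs IHvs] D /=; first by case: eqP.
move=> /andP[vvs uvs]; elim: D => [|D IHD]; first exact: IHvs.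
rewrite cat_uniq IHvs // andbT map_inj_uniq ?IHD; last exact: addmI.
rewrite andTb; apply/hasPn => m /monomialsP[_ /(_ v vvs) mv].
by apply/mapP => -[m' _ mE]; move: mv; rewrite mE mnmDE mnm1E eqxx.
Qed.

(** The predecessor is harmless when D and vs are both empty: 'C(0, 0) = 1. *)
Lemma size_monomials vs D : size (monomials vs D) = 'C((D + size vs).-1, D).
Proof.
elim: vs D => [|v vs IHvs] D.
  by rewrite addn0 size_nseq; case: D => // D; rewrite bin_small.
elim: D => [|D IHD]; first by rewrite IHvs !bin0.
rewrite [monomials _ _]/= size_cat size_map -/(monomials (v :: vs) D) IHD IHvs.
by rewrite /= !addnS /= binS addnC.
Qed.

Lemma card_ord_geq_lt p q : p <= q -> q <= n ->
  #|[pred a : 'I_n | p <= a < q]| = q - p.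
Proof.
move=> pq qn; have := cardID [pred a : 'I_n | a < p] [pred a : 'I_n | a < q].
rewrite card_ord_lt // (@eq_card _ _ [pred a : 'I_n | a < p]); last first.
  by move=> a; rewrite !inE andb_idl // => /leq_trans; apply.
rewrite card_ord_lt ?(leq_trans pq) // => qE.
apply: (@addnI p); rewrite subnKC // -[RHS]qE; congr (_ + _).
by apply: eq_card => a; rewrite !inE -leqNgt.
Qed.

Definition slice_size p q D s := 'C((D - s + p).-1, D - s) * 'C((s + (q - p)).-1, s).

(** Monomials of fixed tail degree s are uniquely a product of a head monomial
    of degree D - s and a tail monomial of degree s. *)
Lemma tail_deg_slice p q D s : p <= q -> q <= n -> s <= D ->
  exists L : seq 'X_{1..n}, [/\ uniq L,
    forall m, (m \in L) = (m \in tail_bounded p q D s) && (tail_deg p m == s) &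
    size L = slice_size p q D s].
Proof.
move=> pq qn sD.
pose hs := enum [pred a : 'I_n | a < p].
pose ts := enum [pred a : 'I_n | p <= a < q].
have hsP h : h \in monomials hs (D - s) -> forall a : 'I_n, p <= a -> h a = 0.
  by move=> /monomialsP[_ h0] a pa; apply: h0; rewrite mem_enum inE -leqNgt.
have tsP t : t \in monomials ts s -> forall a : 'I_n, a < p -> t a = 0.
  by move=> /monomialsP[_ t0] a pa; apply: t0; rewrite mem_enum inE leqNgt pa.
exists [seq (h + t)%MM | h <- monomials hs (D - s), t <- monomials ts s]; split.
- apply: allpairs_uniq; try by apply/monomials_uniq/enum_uniq.
  move=> x y /allpairsP[[h1 t1] /= [h1s t1s ->]] {x}.
  move=> /allpairsP[[h2 t2] /= [h2s t2s ->]] {y} /mnmP /= eq12.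
  congr (_, _); apply/mnmP => a; have := eq12 a; rewrite !mnmDE;
    case: (ltnP a p) => pa.
  + by rewrite (tsP t1) // (tsP t2) // !addn0.
  + by rewrite (hsP h1) // (hsP h2).
  + by rewrite (tsP t1) // (tsP t2).
  by rewrite (hsP h1) // (hsP h2).
- move=> m; apply/allpairsP/andP => [[[h t] /= [hh tt ->]]|].
    have [hD h0] := monomialsP _ _ _ hh; have [tD t0] := monomialsP _ _ _ tt.
    have td : tail_deg p (h + t)%MM = s.
      rewrite tail_degD [X in X + _]big1 ?add0n => [|a]; last exact: hsP.
      rewrite -tD mdegE /tail_deg big_mkcond; apply: eq_bigr => a _.
      by case: leqP => // /(tsP _ tt) ->.
    split; last by rewrite td.
    apply/tail_boundedP; split=> [|a qa|]; last by rewrite td.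
      by rewrite mdegD hD tD subnK.
    rewrite mnmDE (hsP _ hh) ?(leq_trans pq) // t0 //.
    by rewrite mem_enum inE [a < q]ltnNge qa andbF.
  move=> [/tail_boundedP[mD m0 _] /eqP ms].
  exists (head_part p m, tail_part p m); split=> /=; last by rewrite head_tail_partK.
    apply/monomialsP; split=> [|a].
      have := congr1 (@mdeg n) (head_tail_partK p m).
      by rewrite mdegD mdeg_tail_part ms mD => <-; rewrite addnK.
    by rewrite mem_enum inE mnmE => /negbTE ->.
  apply/monomialsP; rewrite mdeg_tail_part ms; split=> // a.
  rewrite mem_enum inE mnmE; case: (ltnP a p) => //= _; rewrite -leqNgt.
  exact: m0.
rewrite size_allpairs !size_monomials -!cardE.
by rewrite card_ord_lt ?card_ord_geq_lt ?(leq_trans pq).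
Qed.

Lemma tail_bounded_enum p q D k : p <= q -> q <= n -> k <= D ->
  exists L : seq 'X_{1..n}, [/\ uniq L, L =i tail_bounded p q D k &
    size L = \sum_(s < k.+1) slice_size p q D s].
Proof.
move=> pq qn; elim: k => [|k IHk] kD.
  have [L [uL LE sL]] := tail_deg_slice pq qn kD.
  exists L; split=> //; last by rewrite big_ord1.
  move=> m; rewrite LE andb_idr // => /tail_boundedP[_ _].
  by rewrite leqn0.
have [L1 [uL1 L1E sL1]] := IHk (ltnW kD).
have [L2 [uL2 L2E sL2]] := tail_deg_slice pq qn kD.
exists (L1 ++ L2); split.
- rewrite cat_uniq uL1 uL2 andbT; apply/hasPn => m; rewrite L2E => /andP[_ /eqP mk].
  by rewrite L1E; apply/tail_boundedP => -[_ _]; rewrite mk ltnn.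
- move=> m; rewrite mem_cat L1E L2E; apply/orP/idP.
    move=> [/tail_boundedP[mD m0 mk]|/andP[] //].
    by apply/tail_boundedP; split=> //; apply: leqW.
  move=> mT; have [mD m0] := tail_boundedP _ _ _ _ _ mT.
  rewrite leq_eqVlt => /orP[mk|mk]; first by right; rewrite mT.
  by left; apply/tail_boundedP.
by rewrite size_cat sL1 sL2 [RHS]big_ord_recr.
Qed.

End Counting.

(** * The Freiman condition *)

Section Freiman.
Variables (K : fieldType) (n : nat).

Lemma analytic_spread_tail_bounded p q d : 0 < p -> p <= q -> q <= n ->
  analytic_spread (mon_ideal K (@tail_bounded n p q d.+1 1)) q.
Proof.
move=> p0 pq qn; have q0 := leq_trans p0 pq; have n0 := leq_trans q0 qn.
apply: (@analytic_spread_mon _ _ _ d q (Ordinal n0)) => //.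
- by move=> g /tail_boundedP[].
- by move=> g /tail_boundedP[].
move=> a aq; apply/tail_boundedP; split.
- by rewrite mdegD mdegMn !mdeg1 mul1n addn1.
- move=> b qb; rewrite mnmDE mulmnE !mnm1E -!val_eqE /=.
  by rewrite (ltn_eqF (leq_trans q0 qb)) (ltn_eqF (leq_trans aq qb)).
by rewrite tail_degD tail_degMn !tail_degU [p <= Ordinal n0]leqNgt p0 mul0n leq_b1.
Qed.

(** All three invariants in the Freiman condition are known; the equation is
    stated additively to stay in the natural numbers. *)
Lemma freiman_tail_bounded p q d : 0 < p -> p <= q -> q <= n -> 0 < d ->
  freiman (mon_ideal K (@tail_bounded n p q d 1)) <->
  \sum_(s < 3) slice_size p q (2 * d) s + 'C(q, 2) =
  q * \sum_(s < 2) slice_size p q d s.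
Proof.
move=> p0 pq qn; case: d => // d _.
have deg k D : {in @tail_bounded n p q D k, forall g, mdeg g = D}.
  by move=> g /tail_boundedP[].
have [L1 [uL1 L1E sL1]] := @tail_bounded_enum n p q d.+1 1 pq qn isT.
have k2 : 2 <= 2 * d.+1 by lia.
have [L2 [uL2 L2E sL2]] := @tail_bounded_enum n p q (2 * d.+1) 2 pq qn k2.
have mu1 := min_number_gens_mon K uL1 L1E (deg _ _).
have := min_number_gens_mon K uL2 L2E (deg _ _).
rewrite -mon_pow_tail_bounded // -ideal_pow_mon => mu2.
have ell := analytic_spread_tail_bounded d p0 pq qn.
rewrite -sL1 -sL2; split.
  move=> [_ [r1 [r2 [l [m1 m2 [lch lmax] E]]]]].
  have <- := min_number_gens_uniq m1 mu1; have <- := min_number_gens_uniq m2 mu2.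
  suff lq : l = q by rewrite lq in E; lia.
  have [[P Pch] qmax] := ell; have [P' P'ch] := lch.
  by apply/eqP; rewrite eqn_leq (qmax _ _ P'ch) (lmax _ _ Pch).
move=> E; split; first exact: (equigenerated_mon_ideal K (deg _ _)).
by exists (size L1), (size L2), q; split=> //; lia.
Qed.

Lemma bin_succ2 k : 2 * 'C(k.+1, 2) = k.+1 * k.
Proof. by rewrite -mul_bin_diag bin1. Qed.

Lemma bin_succ3 k : 6 * 'C(k.+2, 3) = k.+2 * (k.+1 * k).
Proof. by have := mul_bin_diag k.+2 2; have := bin_succ2 k; rewrite /=; nia. Qed.

Lemma bin_succ4 k : 24 * 'C(k.+3, 4) = k.+3 * (k.+2 * (k.+1 * k)).
Proof. by have := mul_bin_diag k.+3 3; have := bin_succ3 k; rewrite /=; nia. Qed.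

Lemma slice_sizeE p m D s : slice_size p (p + m) D s =
  'C((D - s + p).-1, D - s) * 'C((s + m).-1, s).
Proof. by rewrite /slice_size addKn. Qed.

(** For p = 1 both sides are (1 + m)^2, for p = 2 they are
    (2 + m) (d + 1 + d m), where m = q - p. *)
Lemma freiman_equation_le2 p q d : 0 < p -> p <= 2 -> p <= q -> 0 < d ->
  \sum_(s < 3) slice_size p q (2 * d) s + 'C(q, 2) =
  q * \sum_(s < 2) slice_size p q d s.
Proof.
move=> p0 p2 pq d0; rewrite -(subnKC pq); move: (q - p) => m.
rewrite !big_ord_recr !big_ord0 /= !slice_sizeE !add0n !bin0 !muln1 !add1n /= !bin1.
have [->|->] : p = 1 \/ p = 2 by lia.
  have C1 x : 'C((x + 1).-1, x) = 1 by rewrite addn1 binn.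
  by rewrite !C1; have := bin_succ2 m; rewrite !add1n; nia.
have C2 x : 'C((x + 2).-1, x) = x.+1 by rewrite addn2 binSn.
rewrite !C2; have := bin_succ2 m; have := bin_succ2 m.+1.
rewrite !add1n !add2n; case: d d0 => // d _; nia.
Qed.

(** With a = p - 3, the left side exceeds the right side by 1/24 of a
    polynomial in a and m with nonnegative coefficients that vanishes only at
    a = m = 0, that is p = q = 3. *)
Lemma freiman_equation_degree2 p m : 3 <= p -> 4 <= p + m ->
  \sum_(s < 3) slice_size p (p + m) (2 * 2) s + 'C(p + m, 2) <>
  (p + m) * \sum_(s < 2) slice_size p (p + m) 2 s.
Proof.
move=> p3 pm; rewrite -(subnKC p3) in pm *; move: (p - 3) pm => a {p p3} am.
rewrite !big_ord_recr !big_ord0 /= !slice_sizeE !bin0 /= !bin1.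
change ('C(a.+3.+3, 4) * 1 + 'C(a.+3.+2, 3) * m + 'C(a.+3.+1, 2) * 'C(m.+1, 2) +
  'C((a + m).+3, 2) <> (a + m).+3 * ('C(a.+3.+1, 2) * 1 + a.+3 * m)).
have := bin_succ2 m; have := bin_succ2 (a + m).+2; have := bin_succ2 a.+3.
have := bin_succ3 a.+3; have := bin_succ4 a.+3.
move: 'C(_, 4) 'C(_, 3) 'C(a.+4, 2) 'C((a + m).+3, 2) 'C(m.+1, 2) => c4 c3 c2 cq cm.
move=> E4 E3 E2 Eq Em E.
have Em3 : 6 * (c3 * m) = a.+3.+2 * (a.+3.+1 * a.+3) * m by rewrite mulnA E3.
have E22 : 4 * (c2 * cm) = (a.+3.+1 * a.+3) * (m.+1 * m).
  by rewrite -E2 -Em mulnACA.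
have ER : 2 * ((a + m).+3 * c2) = (a + m).+3 * (a.+3.+1 * a.+3).
  by rewrite mulnCA E2.
move: E; rewrite !muln1 mulnDr => {E2 E3 Em}.
move: (c3 * m) (c2 * cm) ((a + m).+3 * c2) Em3 E22 ER => u v w {c3 c2 cm} Eu Ev Ew E.
(* Twenty-four times the difference of the two sides of E. *)
have : a * a * a * a + 6 * (a * a * a) + 11 * (a * a) + 6 * a + 12 * m +
    26 * (a * m) + 12 * (a * a * m) + 4 * (a * a * a * m) + 12 * (m * m) +
    18 * (a * m * m) + 6 * (a * a * m * m) = 0.
  lia.
lia.
Qed.

End Freiman.

(* The variables x_1, ..., x_n are indexed by 'I_n: index i of the text is i.+1. *)
Theorem theorem3p2 (K : fieldType) (n : nat) :
  (forall i j : 'I_n, i <= j ->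
     freiman (principal_borel K (U_(i) + U_(j))%MM) <->
     (j.+1 <= 3 \/ (3 < j.+1 /\ i.+1 <= 2)))
  /\
  (forall (i j : 'I_n) (d : nat), 3 <= d -> i <= j ->
     i.+1 <= 2 ->
     freiman (principal_borel K (U_(i) *+ d.-1 + U_(j))%MM)).
Proof.
split=> [i j ij|i j [//|d] d3 ij i2]; last first.
  rewrite principal_borel_pow //.
  apply/freiman_tail_bounded => //; exact: freiman_equation_le2.
rewrite -[U_(i)%MM]mulm1n principal_borel_pow //.
have [_ fr] :=
  freiman_tail_bounded K (ltn0Sn i) (ij : i.+1 <= j.+1) (ltn_ord j) (ltn0Sn 1).
split=> [|ij3].
  case: (leqP i.+1 2) => i2; first by case: (leqP j.+1 3) => j3; [left | right].
  case: (leqP j.+1 3) => j3; first by left.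
  move/(freiman_tail_bounded K (ltn0Sn i) (ij : i.+1 <= j.+1) (ltn_ord j) (ltn0Sn 1)).
  have -> : j.+1 = i.+1 + (j - i) by rewrite addSn subnKC.
  by move/freiman_equation_degree2 => H; case: H => //; rewrite addSn subnKC.
apply: fr; case: (leqP i.+1 2) => i2; first exact: freiman_equation_le2.
have [-> ->] : i.+1 = 3 /\ j.+1 = 3 by lia.
by rewrite !big_ord_recr !big_ord0.
Qed.
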